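(* Let $\mathrm{BP}$ be a binary program in $n$ variables with constraints $Ax\leq b$, $x\in\{0,1\}^n$, where $A\in\mathbb{R}^{m\times n}$, $b\in\mathbb{R}^m$ and $\operatorname{Fes}(\mathrm{BP})\neq\emptyset$. Assume that for each $i\in\{1,\ldots,n\}$ there exists $x\in\operatorname{Fes}(\mathrm{BP})$ such that $x_i=1$. Suppose that for each $\bar{x}\in\operatorname{Fes}(\mathrm{BP})$ there exists a $\bar{y}\in\operatorname{Fes}(\mathrm{BP})$ such that $\bar{x}+\bar{y}\leq e$. Then $x_{i}+y_{i}-z_{i}\leq 1$ defines a facet of $P^{n}_{\overline{\mathrm{BPD}}}$, for all $i\in\{1,\ldots,n\}$.
   Context: $\operatorname{Fes}(\mathrm{BP})=\{x\in\{0,1\}^n: Ax\leq b\}$. $e$ is the all-ones vector, inequalities between vectors are entrywise, and $\oplus$ denotes concatenation of vectors. The diameter polytope is $P^{n}_{\overline{\mathrm{BPD}}}=\operatorname{conv}\{x\oplus y\oplus z\in\{0,1\}^{3n}: Ax\leq b,\ Ay\leq b,\ x+y-z\leq e\}\subseteq\mathbb{R}^{3n}$; points of $\mathbb{R}^{3n}$ are written $x\oplus y\oplus z$ with $x,y,z\in\mathbb{R}^n$. The dimension of a nonempty polytope is the dimension of its affine hull. If $a^Tw\leq a_0$ is a valid inequality for a polytope $P$, the face it defines is $\{w\in P: a^Tw=a_0\}$; a facet of $P$ is a face of dimension $\dim P-1$, and an inequality defines a facet if it is valid for $P$ and the face it defines is a facet. *)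

(* Defs.v *)
From mathcomp Require Import all_boot all_order all_algebra.
From mathcomp Require Import boolp classical_sets reals.

Set Implicit Arguments.
Unset Strict Implicit.
Unset Printing Implicit Defensive.

Import Order.TTheory GRing.Theory Num.Theory.
Local Open Scope classical_set_scope.
Local Open Scope ring_scope.

Definition vec_le (R : realType) (n : nat) (u v : 'cV[R]_n) : Prop :=
  forall i, u i 0 <= v i 0.

Definition binary (R : realType) (n : nat) (x : 'cV[R]_n) : Prop :=
  forall i, x i 0 = 0 \/ x i 0 = 1.

Definition all_ones (R : realType) (n : nat) : 'cV[R]_n := const_mx 1.
Arguments all_ones {R n}.

Definition Fes (R : realType) (m n : nat) (A : 'M[R]_(m, n)) (b : 'cV[R]_m) :
    set 'cV[R]_n :=
  [set x | binary x /\ vec_le (A *m x) b].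

(* R^{3n} is represented as 'cV[R]_(n + n + n). *)
Definition cat3 (R : realType) (n : nat) (x y z : 'cV[R]_n) :
    'cV[R]_(n + n + n) :=
  col_mx (col_mx x y) z.

(* The empty combination (k = 0) is ruled out by the coefficients summing to 1. *)
Definition conv (R : realType) (N : nat) (S : set 'cV[R]_N) : set 'cV[R]_N :=
  [set w | exists (k : nat) (c : 'I_k -> R) (v : 'I_k -> 'cV[R]_N),
     [/\ forall j, 0 <= c j, \sum_(j < k) c j = 1,
         forall j, S (v j) & w = \sum_(j < k) c j *: v j]].

Definition aff (R : realType) (N : nat) (S : set 'cV[R]_N) : set 'cV[R]_N :=
  [set w | exists (k : nat) (c : 'I_k -> R) (v : 'I_k -> 'cV[R]_N),
     [/\ \sum_(j < k) c j = 1,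
         forall j, S (v j) & w = \sum_(j < k) c j *: v j]].

(* aff S is a translate p + U of a linear subspace U of dimension d.
   No d satisfies this when S is empty. *)
Definition has_dim (R : realType) (N : nat) (S : set 'cV[R]_N) (d : nat) : Prop :=
  exists (p : 'cV[R]_N) (U : {vspace 'cV[R]_N}),
    aff S = [set p + u | u in [set u | u \in U]] /\ \dim U = d.

Definition dotv (R : realType) (N : nat) (a w : 'cV[R]_N) : R :=
  (a^T *m w) 0 0.

Definition valid_ineq (R : realType) (N : nat) (P : set 'cV[R]_N)
    (a : 'cV[R]_N) (a0 : R) : Prop :=
  forall w, P w -> dotv a w <= a0.

Definition face_of (R : realType) (N : nat) (P : set 'cV[R]_N)
    (a : 'cV[R]_N) (a0 : R) : set 'cV[R]_N :=
  [set w | P w /\ dotv a w = a0].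

Definition is_face (R : realType) (N : nat) (P F : set 'cV[R]_N) : Prop :=
  exists (a : 'cV[R]_N) (a0 : R), valid_ineq P a a0 /\ F = face_of P a a0.

Definition is_facet (R : realType) (N : nat) (P F : set 'cV[R]_N) : Prop :=
  is_face P F /\ exists d : nat, has_dim P d.+1 /\ has_dim F d.

Definition defines_facet (R : realType) (N : nat) (P : set 'cV[R]_N)
    (a : 'cV[R]_N) (a0 : R) : Prop :=
  valid_ineq P a a0 /\ is_facet P (face_of P a a0).

Definition BPD_polytope (R : realType) (m n : nat)
    (A : 'M[R]_(m, n)) (b : 'cV[R]_m) : set 'cV[R]_(n + n + n) :=
  conv [set w | exists x y z : 'cV[R]_n,
    [/\ w = cat3 x y z, binary w, vec_le (A *m x) b, vec_le (A *m y) b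
      & vec_le (x + y - z) all_ones]].

(* Coefficient vector of x_i + y_i - z_i. *)
Definition xyz_coef (R : realType) (n : nat) (i : 'I_n) : 'cV[R]_(n + n + n) :=
  cat3 (delta_mx i 0) (delta_mx i 0) (- delta_mx i 0).
Arguments xyz_coef {R n} i.

Lemma dotv_xyz_coef (R : realType) (n : nat) (i : 'I_n) (x y z : 'cV[R]_n) :
  dotv (xyz_coef i) (cat3 x y z) = x i 0 + y i 0 - z i 0.
Proof.
have e_row (u : 'cV[R]_n) : ((delta_mx i 0 : 'cV[R]_n)^T *m u) 0 0 = u i 0.
  by rewrite trmx_delta -rowE mxE.
rewrite /dotv /xyz_coef /cat3 !tr_col_mx !mul_row_col linearN mulNmx.
by rewrite mxE [X in X + _]mxE [X in _ + X]mxE !e_row.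
Qed.

(* Main.v *)
Require Import Defs.
From mathcomp Require Import all_boot all_order all_algebra.
From mathcomp Require Import boolp classical_sets reals.
From mathcomp Require Import lra.
Import Order.TTheory GRing.Theory Num.Theory.
Local Open Scope classical_set_scope.
Local Open Scope ring_scope.

(** The generators of the polytope are the triples [cat3 x y z] with [x], [y]
    feasible and [z] binary and large enough.  Fix a feasible [s] with
    [s i = 1] and a feasible [t] with disjoint support.  The point
    [p = cat3 s t 0] is then a generator lying on the face
    [x_i + y_i - z_i = 1], whereas [q = cat3 s t e_i], with [e_i] the [i]-th
    unit vector, is a generator off the face.

    Adjoining one point off a proper face raises the dimension by exactly one,
    so the face is a facet as soon as every flat through [p] that contains the
    face and [q] contains the whole polytope ([facet_criterion]).  Writing [W]
    for the direction space of such a flat, three families of directions are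
    to be found in [W] ([BPD_directions]):
    - [cat3 0 0 e_j]: for [j = i] it is [q - p]; for the other [j], both
      [p] and [cat3 s t e_j] lie on the face, the value [0] of the [j]-th
      entry of [z] being allowed because [s] and [t] are disjoint;
    - [cat3 (x - s) 0 0] for [x] feasible: since [s i = 1], the pair [(x, s)]
      extends to a point of the face for every [x], with [z i = x i] and the
      other entries of [z] equal to [1]; subtracting the point obtained from
      [(s, s)] gives [x - s] in the first block, up to a multiple of
      [cat3 0 0 e_i];
    - [cat3 0 (y - s) 0], by the same argument with the pairs [(s, y)].
    The difference of any generator and [p] is a combination of these. *)

(** * Affine hulls and dimension *)

Lemma conv_sub_aff {R : realType} {N : nat} (S : set 'cV[R]_N) :
  conv S `<=` aff S.
Proof. by move=> w [k [c [v [_ c1 Sv ->]]]]; exists k, c, v. Qed.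

Lemma sub_conv {R : realType} {N : nat} (S : set 'cV[R]_N) : S `<=` conv S.
Proof.
move=> w Sw; exists 1%N, (fun=> 1), (fun=> w); split => //.
- by rewrite big_ord1.
- by rewrite big_ord1 scale1r.
Qed.

Lemma aff_sub_flat {R : realType} {N : nat} {S : set 'cV[R]_N} {p : 'cV[R]_N}
    {W : {vspace 'cV[R]_N}} :
  (forall w, S w -> w - p \in W) -> forall w, aff S w -> w - p \in W.
Proof.
move=> SW w [k [c [v [c1 Sv ->]]]].
rewrite -[p in _ - p]scale1r -c1 scaler_suml -sumrB.
by apply: memv_suml => j _; rewrite -scalerBr memvZ // SW.
Qed.

Lemma has_dim_span {R : realType} {N : nat} (S : set 'cV[R]_N) (p : 'cV[R]_N)
    (X : seq 'cV[R]_N) :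
  S p -> (forall x, x \in X -> S (p + x)) ->
  (forall w, S w -> w - p \in <<X>>%VS) -> has_dim S (\dim <<X>>%VS).
Proof.
move=> Sp SX XS; exists p, <<X>>%VS; split => //.
apply/seteqP; split=> [w /(aff_sub_flat XS) Xw|_ [u /= Xu <-]].
  by exists (w - p) => //=; rewrite addrC subrK.
have -> := coord_span (X := in_tuple X) Xu.
set c := fun j => coord (in_tuple X) j u.
(* The slot [None] is for [p], whose weight makes the weights sum to [1]. *)
exists (size X).+1,
  (fun j => if unlift ord0 j is Some j' then c j' else 1 - \sum_j c j),
  (fun j => if unlift ord0 j is Some j' then p + X`_j' else p).
split.
- rewrite big_ord_recl unlift_none [X in _ + X](eq_bigr c) ?subrK //.
  by move=> j _; rewrite liftK.
- by move=> j; case: unliftP => [j' _|_ //]; exact/SX/mem_nth.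
- rewrite big_ord_recl unlift_none.
  rewrite [X in _ = _ + X](eq_bigr (fun j => c j *: p + c j *: X`_j)).
    by rewrite big_split /= -scaler_suml addrA -scalerDl subrK scale1r.
  by move=> j _; rewrite liftK scalerDr.
Qed.

Lemma dim_line_add {R : realType} {N : nat} (v : 'cV[R]_N)
    (U : {vspace 'cV[R]_N}) :
  v \notin U -> \dim (<[v]> + U) = (\dim U).+1.
Proof.
move=> vU; have v0 : v != 0 by apply: contraNneq vU => ->; rewrite mem0v.
rewrite dimv_disjoint_sum ?dim_vline ?v0 //; apply/eqP; rewrite -subv0.
apply/subvP => _ /memv_capP[/vlineP[k ->] kvU]; rewrite memv0 scaler_eq0.
apply: contraNT vU; rewrite negb_or => /andP[k0 _].
by rewrite -[v](scalerK k0) memvZ.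
Qed.

(** A spanning family of directions at [p] exists because the dimensions of
    the spans of finite families are bounded by [N]: a family with a span of
    maximal dimension cannot miss any point of [S]. *)
Lemma spanning_directions {R : realType} {N : nat} (S : set 'cV[R]_N)
    (p : 'cV[R]_N) :
  exists X : seq 'cV[R]_N, (forall x, x \in X -> S (p + x)) /\
    (forall w, S w -> w - p \in <<X>>%VS).
Proof.
pose dims d := `[< exists X : seq 'cV[R]_N,
  (forall x, x \in X -> S (p + x)) /\ \dim <<X>>%VS = d >].
have dims_ex : exists d, dims d.
  by exists (\dim <<[::] : seq 'cV[R]_N>>%VS); apply/asboolP; exists [::].
have dims_ub d : dims d -> (d <= \dim {:'cV[R]_N})%N.
  by move=> /asboolP[X [_ <-]]; apply/dimvS/subvf.
case: (ex_maxnP dims_ex dims_ub) => d /asboolP[X [SX dX]] maxd.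
exists X; split=> // w Sw; apply: contraT => wX.
suff /maxd : dims d.+1 by rewrite ltnn.
apply/asboolP; exists (w - p :: X); split; last first.
  by rewrite span_cons dim_line_add ?dX.
by move=> x; rewrite inE => /predU1P[->|/SX //]; rewrite addrC subrK.
Qed.

Lemma dotvB {R : realType} {N : nat} (a u v : 'cV[R]_N) :
  dotv a (u - v) = dotv a u - dotv a v.
Proof. by rewrite /dotv mulmxBr !mxE. Qed.

Lemma dotv_sum {R : realType} {N k : nat} (a : 'cV[R]_N) (c : 'I_k -> R)
    (v : 'I_k -> 'cV[R]_N) :
  dotv a (\sum_j c j *: v j) = \sum_j c j * dotv a (v j).
Proof.
rewrite /dotv mulmx_sumr summxE; apply: eq_bigr => j _.
by rewrite -scalemxAr mxE.
Qed.

Lemma valid_ineq_conv {R : realType} {N : nat} (S : set 'cV[R]_N)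
    (a : 'cV[R]_N) (a0 : R) :
  valid_ineq S a a0 -> valid_ineq (conv S) a a0.
Proof.
move=> Sa w [k [c [v [c0 c1 Sv ->]]]].
rewrite dotv_sum -[a0]mul1r -c1 mulr_suml.
by apply: ler_sum => j _; rewrite ler_wpM2l ?Sa.
Qed.

(** The last hypothesis says that every flat through [p] that contains the
    face and [q] contains [P].  Hence [q] and the face span the affine hull of
    [P]; as the face lies in a hyperplane avoiding [q], its dimension is one
    less. *)
Lemma facet_criterion {R : realType} {N : nat} (P : set 'cV[R]_N)
    (a : 'cV[R]_N) (a0 : R) (p q : 'cV[R]_N) :
  valid_ineq P a a0 -> face_of P a a0 p -> P q -> dotv a q != a0 ->
  (forall W : {vspace 'cV[R]_N},
     (forall w, face_of P a a0 w -> w - p \in W) -> q - p \in W ->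
     forall w, P w -> w - p \in W) ->
  defines_facet P a a0.
Proof.
move=> Pa Fp Pq aq flat; split=> //; split; first by exists a, a0.
have [X [FX XF]] := spanning_directions (face_of P a a0) p.
exists (\dim <<X>>%VS); split; last exact: has_dim_span XF.
have qX : q - p \notin <<X>>%VS.
  apply: contraNN aq => /(coord_span (X := in_tuple X)) qpE.
  rewrite -subr_eq0 -Fp.2 -dotvB qpE dotv_sum big1 // => j _.
  have [_] := FX _ (mem_nth 0 (ltn_ord j)); rewrite -Fp.2 => /eqP.
  by rewrite -subr_eq0 -dotvB addrC addKr => /eqP ->; rewrite mulr0.
rewrite -(dim_line_add _ _ qX) -span_cons; apply: has_dim_span Fp.1 _ _.
  by move=> x; rewrite inE => /predU1P[->|/FX[]//]; rewrite addrC subrK.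
rewrite span_cons; apply: flat => [w Fw|].
  exact/(subvP (addvSr _ _))/XF.
exact/(subvP (addvSl _ _))/memv_line.
Qed.

(** * The diameter polytope *)

Lemma binary_cat3 {R : realType} {n : nat} (x y z : 'cV[R]_n) :
  binary (cat3 x y z) <-> [/\ binary x, binary y & binary z].
Proof.
split=> [xyz|[bx by_ bz] j].
  split=> j; [have := xyz (lshift n (lshift n j)) |
    have := xyz (lshift n (rshift n j)) | have := xyz (rshift (n + n) j)];
  by rewrite /cat3 ?(col_mxEu, col_mxEd).
rewrite /cat3; case: (split_ordP j) => k ->; rewrite ?(col_mxEu, col_mxEd) //.
by case: (split_ordP k) => l ->; rewrite ?(col_mxEu, col_mxEd).
Qed.

Lemma cat3B {R : realType} {n : nat} (x y z x' y' z' : 'cV[R]_n) :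
  cat3 x y z - cat3 x' y' z' = cat3 (x - x') (y - y') (z - z').
Proof. by rewrite /cat3 !opp_col_mx !add_col_mx. Qed.

Lemma cat3D {R : realType} {n : nat} (x y z x' y' z' : 'cV[R]_n) :
  cat3 x y z + cat3 x' y' z' = cat3 (x + x') (y + y') (z + z').
Proof. by rewrite /cat3 !add_col_mx. Qed.

Lemma BPD_generator {R : realType} {m n : nat} (A : 'M[R]_(m, n))
    (b : 'cV[R]_m) (x y z : 'cV[R]_n) :
  Fes A b x -> Fes A b y -> binary z ->
  (forall j, x j 0 + y j 0 - z j 0 <= 1) -> BPD_polytope A b (cat3 x y z).
Proof.
move=> [bx Ax] [by_ Ay] bz xyz; apply: sub_conv; exists x, y, z; split=> //.
  exact/binary_cat3.
by move=> j; have := xyz j; rewrite !mxE.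
Qed.

Lemma BPD_face_generator {R : realType} {m n : nat} (A : 'M[R]_(m, n))
    (b : 'cV[R]_m) (i : 'I_n) (x y z : 'cV[R]_n) :
  Fes A b x -> Fes A b y -> binary z ->
  (forall j, x j 0 + y j 0 - z j 0 <= 1) -> x i 0 + y i 0 - z i 0 = 1 ->
  face_of (BPD_polytope A b) (xyz_coef i) 1 (cat3 x y z).
Proof.
by move=> ? ? ? ? ?; split;
   [exact: BPD_generator | rewrite dotv_xyz_coef].
Qed.

Lemma valid_ineq_BPD {R : realType} {m n : nat} (A : 'M[R]_(m, n))
    (b : 'cV[R]_m) (i : 'I_n) :
  valid_ineq (BPD_polytope A b) (xyz_coef i) 1.
Proof.
apply: valid_ineq_conv => _ [x [y [z [-> _ _ _ /(_ i)]]]].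
by rewrite dotv_xyz_coef !mxE.
Qed.

Lemma binary_delta {R : realType} {n : nat} (j : 'I_n) :
  binary (delta_mx j 0 : 'cV[R]_n).
Proof. by move=> k; rewrite mxE andbT; case: eqP => _; [right|left]. Qed.

Lemma binary_le1 {R : realType} {n : nat} (x : 'cV[R]_n) (j : 'I_n) :
  binary x -> x j 0 <= 1.
Proof. by move=> /(_ j)[] ->; rewrite ?ler01. Qed.

Lemma disjoint_eq0 {R : realType} {n : nat} (s t : 'cV[R]_n) (i : 'I_n) :
  binary t -> vec_le (s + t) all_ones -> s i 0 = 1 -> t i 0 = 0.
Proof.
move=> bt /(_ i); rewrite !mxE => st si; move: st; rewrite si.
by case: (bt i) => ->; rewrite ?gerDl ?ler10.
Qed.

(** The largest binary [z] for which [cat3 x s z] and [cat3 s x z] lie on the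
    face, given that [s i = 1]: its entry at [i] is then forced, and the other
    entries are set to [1] so that they constrain neither [x] nor [s]. *)
Definition tight_z {R : realType} {n : nat} (i : 'I_n) (x : 'cV[R]_n) :
    'cV[R]_n :=
  \col_j (if j == i then x i 0 else 1).

Lemma binary_tight_z {R : realType} {n : nat} (i : 'I_n) (x : 'cV[R]_n) :
  binary x -> binary (tight_z i x).
Proof. by move=> bx j; rewrite mxE; case: eqP => // _; right. Qed.

Lemma tight_z_face {R : realType} {m n : nat} (A : 'M[R]_(m, n))
    (b : 'cV[R]_m) (i : 'I_n) (s x : 'cV[R]_n) :
  Fes A b s -> s i 0 = 1 -> Fes A b x ->
  face_of (BPD_polytope A b) (xyz_coef i) 1 (cat3 x s (tight_z i x)) /\
  face_of (BPD_polytope A b) (xyz_coef i) 1 (cat3 s x (tight_z i x)).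
Proof.
move=> Fs si Fx; have bz := binary_tight_z i _ Fx.1.
have le1 j : x j 0 + s j 0 - tight_z i x j 0 <= 1.
  rewrite mxE; case: eqP => [->|_].
    by rewrite si addrC addKr.
  by have := binary_le1 x j Fx.1; have := binary_le1 s j Fs.1; lra.
have eq1 : x i 0 + s i 0 - tight_z i x i 0 = 1.
  by rewrite mxE eqxx si addrC addKr.
by split; apply: BPD_face_generator => // [j|]; rewrite [s _ _ + _]addrC.
Qed.

(** The directions found here span the difference of any generator and
    [cat3 s t 0].  The [z]-directions have to come first: two points of the
    face that differ in the entry [x i] or [y i] also differ in [z i] as soon
    as the other of these two entries is kept equal to [1], and this change
    of [z] is then subtracted. *)
Lemma BPD_directions {R : realType} {m n : nat} (A : 'M[R]_(m, n))
    (b : 'cV[R]_m) (i : 'I_n) (s t : 'cV[R]_n)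
    (W : {vspace 'cV[R]_(n + n + n)}) :
  Fes A b s -> s i 0 = 1 -> Fes A b t -> vec_le (s + t) all_ones ->
  (forall w, face_of (BPD_polytope A b) (xyz_coef i) 1 w ->
     w - cat3 s t 0 \in W) ->
  cat3 0 0 (delta_mx i 0) \in W ->
  [/\ forall z, cat3 0 0 z \in W,
      forall x, Fes A b x -> cat3 (x - s) 0 0 \in W
    & forall y, Fes A b y -> cat3 0 (y - s) 0 \in W].
Proof.
move=> Fs si Ft st FW iW.
have st1 j : s j 0 + t j 0 <= 1 by have := st j; rewrite !mxE.
have ti := disjoint_eq0 s t i Ft.1 st si.
have FBW u v : face_of (BPD_polytope A b) (xyz_coef i) 1 u ->
    face_of (BPD_polytope A b) (xyz_coef i) 1 v -> u - v \in W.
  move=> /FW uW /FW vW; have := memvB uW vW.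
  by rewrite opprB addrA subrK.
have jW j : cat3 0 0 (delta_mx j 0) \in W.
  have [->//|ji] := eqVneq j i.
  have -> : cat3 0 0 (delta_mx j 0) = cat3 s t (delta_mx j 0) - cat3 s t 0.
    by rewrite cat3B !subrr subr0.
  apply/FW/BPD_face_generator => //; first exact: binary_delta.
    by move=> k; have := st1 k; case: (@binary_delta R n j k) => ->; lra.
  by rewrite mxE eq_sym (negPf ji) si ti addr0 subr0.
have zW z : cat3 0 0 z \in W.
  have -> : cat3 0 0 z = \sum_j z j 0 *: cat3 0 0 (delta_mx j 0).
    rewrite /cat3 col_mx0 [z in LHS]matrix_sum_delta.
    rewrite (big_morph (col_mx 0) (id1 := 0) (op1 := +%R)).
    - by apply: eq_bigr => j _; rewrite big_ord1 scale_col_mx scaler0.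
    - by move=> u v; rewrite add_col_mx addr0.
    - exact: col_mx0.
  by apply: memv_suml => j _; rewrite memvZ.
split=> // x Fx.
  have [xF _] := tight_z_face A b i s x Fs si Fx.
  have [sF _] := tight_z_face A b i s s Fs si Fs.
  have := memvB (FBW _ _ xF sF) (zW (tight_z i x - tight_z i s)).
  by rewrite !cat3B !subrr !subr0.
have [_ xF] := tight_z_face A b i s x Fs si Fx.
have [_ sF] := tight_z_face A b i s s Fs si Fs.
have := memvB (FBW _ _ xF sF) (zW (tight_z i x - tight_z i s)).
by rewrite !cat3B !subrr !subr0.
Qed.

Theorem theorem2p13 (R : realType) (m n : nat)
    (A : 'M[R]_(m, n)) (b : 'cV[R]_m)
    (Fes_neq0 : Fes A b !=set0)
    (each_var : forall i : 'I_n, exists x : 'cV[R]_n, Fes A b x /\ x i 0 = 1)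
    (disjoint_mate : forall xbar : 'cV[R]_n, Fes A b xbar ->
       exists ybar : 'cV[R]_n, Fes A b ybar /\ vec_le (xbar + ybar) all_ones) :
  forall i : 'I_n, defines_facet (BPD_polytope A b) (xyz_coef i) 1.
Proof.
move=> i; have [s [Fs si]] := each_var i.
have [t [Ft st]] := disjoint_mate s Fs.
have st1 j : s j 0 + t j 0 <= 1 by have := st j; rewrite !mxE.
have ti := disjoint_eq0 s t i Ft.1 st si.
apply: (facet_criterion _ _ _ (cat3 s t 0) (cat3 s t (delta_mx i 0))).
- exact: valid_ineq_BPD.
- apply: BPD_face_generator => //.
  + by move=> j; left; rewrite mxE.
  + by move=> j; rewrite mxE subr0.
  + by rewrite mxE si ti addr0 subr0.
- apply: BPD_generator => //; first exact: binary_delta.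
  by move=> k; have := st1 k; case: (@binary_delta R n i k) => ->; lra.
- by rewrite dotv_xyz_coef mxE !eqxx si ti addr0 subrr eq_sym oner_eq0.
move=> W FW; rewrite cat3B !subrr subr0 => iW w /conv_sub_aff.
have [zW xW yW] := BPD_directions A b i s t W Fs si Ft st FW iW.
apply: aff_sub_flat => _ [x [y [z [-> /binary_cat3[bx by_ _] Ax Ay _]]]].
(* [y - t] splits as [(y - s) - (t - s)]. *)
have := memvD (memvD (xW x (conj bx Ax)) (zW z))
  (memvB (yW y (conj by_ Ay)) (yW t Ft)).
by rewrite !cat3B !cat3D !(subr0, addr0, add0r) opprB addrA subrK.
Qed.
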